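(* (a) Let $R$ be a unitary ring and let $a\in R$. (i) If $a$ is group invertible and $n\in\mathbb{N}$, then $$R^{\parallel a^n}=R^{\parallel (a^\sharp)^n}=R^{\parallel 1-p_a}.$$ In addition, if $x$ belongs to one of these sets, then $x^{\parallel a^n}=x^{\parallel (a^\sharp)^n}=x^{\parallel 1-p_a}$. (ii) If $a$ is Drazin invertible with $\mathrm{ind}(a)=k$, $n\in\mathbb{N}$, $1\le j\le k-1$ and $m\ge k$, then $$R^{\parallel (a^d)^n}=R^{\parallel a^m}=R^{\parallel a^ja^da}=R^{\parallel 1-a^\pi}.$$ Moreover, if $x$ belongs to one of these sets, then $x^{\parallel (a^d)^n}=x^{\parallel a^m}=x^{\parallel a^ja^da}=x^{\parallel 1-a^\pi}$. (iii) If $a$ is generalized Drazin invertible and $n\in\mathbb{N}$, then $$R^{\parallel (a^D)^n}=R^{\parallel a^na^Da}=R^{\parallel 1-a^\pi}.$$ Furthermore, if $x$ belongs to one of these sets, then $x^{\parallel (a^D)^n}=x^{\parallel a^na^Da}=x^{\parallel 1-a^\pi}$. (b) Let $R$ be a unitary ring with involution. (iv) If $a\in R$ is EP and $n\in\mathbb{N}$, then $$R^{\parallel a^n}=R^{\parallel (a^\dagger)^n}=R^{\parallel (a^* )^n}=R^{\parallel ((a^\dagger)^* )^n}=R^{\parallel aa^\dagger}.$$ If $x$ belongs to one of these sets, then $x^{\parallel a^n}=x^{\parallel (a^\dagger)^n}=x^{\parallel (a^* )^n}=x^{\parallel ((a^\dagger)^* )^n}=x^{\parallel aa^\dagger}$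.
   Context: $R$ is an associative ring with unit $1$; $\mathbb{N}=\{1,2,\dots\}$; $R^{-1}$ is the set of invertible elements of $R$. An element $x$ is invertible along $d$ if there is $b\in R$ with $b=bxb$, $bR=dR$ and $Rb=Rd$; such $b$ is unique and is denoted $x^{\parallel d}$. $R^{\parallel d}$ denotes the set of all $x\in R$ invertible along $d$. Group invertible: there is a (necessarily unique) $a^\sharp\in R$ with $aa^\sharp a=a$, $a^\sharp aa^\sharp=a^\sharp$, $aa^\sharp=a^\sharp a$; then $p_a:=1-a^\sharp a$. Drazin invertible: there is a (necessarily unique) $a^d\in R$ with $a^ma^da=a^m$, $a^daa^d=a^d$, $aa^d=a^da$ for some $m\in\mathbb{N}$; the smallest such $m$ is the Drazin index $\mathrm{ind}(a)$. In this case $a^\pi=1-aa^d$. For $c\in R$, $\mathrm{comm}(c)=\{x\in R: cx=xc\}$ and $\mathrm{comm}^2(c)=\{x\in R: xy=yx\text{ for all }y\in\mathrm{comm}(c)\}$. An element $q$ is quasinilpotent if $1+xq\in R^{-1}$ for every $x\in\mathrm{comm}(q)$; $R^{qnil}$ is the set of quasinilpotent elements. Generalized Drazin invertible: there is a (necessarily unique) $a^D\in\mathrm{comm}^2(a)$ with $a(a^D)^2=a^D$ and $a^2a^D-a\in R^{qnil}$. In this case $a^\pi=1-aa^D$ (if $a$ is Drazin invertible then $a^D=a^d$). An involution $*:R\to R$ satisfies $(a+b)^*=a^*+b^*$, $(ab)^*=b^*a^*$, $(a^* )^*=a$. Moore-Penrose invertible: there is a (necessarily unique) $a^\dagger\in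 R$ with $aa^\dagger a=a$, $a^\dagger aa^\dagger=a^\dagger$, $(aa^\dagger)^*=aa^\dagger$, $(a^\dagger a)^*=a^\dagger a$. A Moore-Penrose invertible $a$ is EP if $aa^\dagger=a^\dagger a$. *)

(* Defs.v *)
From HB Require Import structures.
From mathcomp Require Import all_boot ssralg boolp classical_sets.

Set Implicit Arguments.
Unset Strict Implicit.
Unset Printing Implicit Defensive.

Import GRing.Theory.
Local Open Scope classical_set_scope.
Local Open Scope ring_scope.

(* [pzRingType] is an arbitrary associative ring with 1; it does not assume
   1 != 0, nor decidable invertibility as [unitRingType] does.
   Each kind of inverse is given by its defining relation [is_*], by the
   predicate saying that such an inverse exists, and by a total function
   returning the inverse when it exists and 0 otherwise. *)
Section GeneralizedInverses.
Variable R : pzRingType.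
Implicit Types a b c d u q x : R.

Definition right_ideal d : set R := range (fun r => d * r).
Definition left_ideal d : set R := range (fun r => r * d).

Definition is_inv_along d x b : Prop :=
  [/\ b = b * x * b, right_ideal b = right_ideal d
    & left_ideal b = left_ideal d].

Definition invertible_along d : set R := [set x | exists b, is_inv_along d x b].

Definition inv_along x d : R := xget 0 (is_inv_along d x).

Definition is_group_inv a b : Prop :=
  [/\ a * b * a = a, b * a * b = b & a * b = b * a].

Definition group_invertible a : Prop := exists b, is_group_inv a b.

Definition group_inv a : R := xget 0 (is_group_inv a).

Definition group_idem a : R := 1 - group_inv a * a.

Definition is_drazin_inv_at (m : nat) a b : Prop :=
  [/\ a ^+ m * b * a = a ^+ m, b * a * b = b & a * b = b * a].

Definition is_drazin_inv a b : Prop :=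
  exists2 m : nat, (0 < m)%N & is_drazin_inv_at m a b.

Definition drazin_invertible a : Prop := exists b, is_drazin_inv a b.

Definition drazin_inv a : R := xget 0 (is_drazin_inv a).

Definition is_drazin_index a (k : nat) : Prop :=
  [/\ (0 < k)%N, is_drazin_inv_at k a (drazin_inv a)
    & forall m, (0 < m)%N -> is_drazin_inv_at m a (drazin_inv a) ->
        (k <= m)%N].

Definition drazin_pi a : R := 1 - a * drazin_inv a.

Definition commutant c : set R := [set x | c * x = x * c].

Definition bicommutant c : set R :=
  [set x | forall y, commutant c y -> x * y = y * x].

Definition invertible u : Prop := exists v, u * v = 1 /\ v * u = 1.

Definition quasinilpotent q : Prop :=
  forall x, commutant q x -> invertible (1 + x * q).

Definition is_gdrazin_inv a b : Prop :=
  [/\ bicommutant a b, a * b ^+ 2 = b & quasinilpotent (a ^+ 2 * b - a)].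

Definition gdrazin_invertible a : Prop := exists b, is_gdrazin_inv a b.

Definition gdrazin_inv a : R := xget 0 (is_gdrazin_inv a).

Definition gdrazin_pi a : R := 1 - a * gdrazin_inv a.

Definition is_ring_involution (star : R -> R) : Prop :=
  [/\ forall a b, star (a + b) = star a + star b,
      forall a b, star (a * b) = star b * star a
    & forall a, star (star a) = a].

Variable star : R -> R.

Definition is_mp_inv a b : Prop :=
  [/\ a * b * a = a, b * a * b = b, star (a * b) = a * b
    & star (b * a) = b * a].

Definition mp_invertible a : Prop := exists b, is_mp_inv a b.

Definition mp_inv a : R := xget 0 (is_mp_inv a).

Definition is_EP a : Prop := mp_invertible a /\ a * mp_inv a = mp_inv a * a.

End GeneralizedInverses.

(* Main.v *)
Require Import Defs.
From mathcomp Require Import all_boot ssralg boolp classical_sets.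

Set Implicit Arguments.
Unset Strict Implicit.
Unset Printing Implicit Defensive.

Import GRing.Theory.
Local Open Scope classical_set_scope.
Local Open Scope ring_scope.

(** Invertibility of [x] along [d], and the inverse itself, depend on [d] only
    through the one-sided ideals [d * R] and [R * d].  It is therefore enough
    to see that all the elements being compared generate the same two ideals.

    If [b] is a group inverse of [a], then [a], [b] and the idempotent [a * b]
    generate the same left and right ideals, because each is a multiple of the
    others on both sides; and [a ^+ n], [b ^+ n] are again mutually group
    inverse with [a ^+ n * b ^+ n = a * b].  So every positive power of [a] or
    of [b] defines the same invertibility notion as [a * b]
    ([is_inv_along_exp]).

    The other three cases reduce to this one.  If [b] is a Drazin or a
    generalized Drazin inverse of [a], it is an outer inverse commuting with
    [a], and hence a group inverse of the core [a * b * a] ([core_group_inv]).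
    The element [a ^+ j * b * a] is the [j]-th power of the core, and so is
    [a ^+ m] from the Drazin index on.  If [a] is EP, its
    Moore-Penrose inverse is a group inverse, and the involution carries this
    group-inverse pair to another one with the same idempotent, since
    [a * b] is self-adjoint. *)

Section CommonIdeals.
Variable R : pzRingType.
Implicit Types a b d e x : R.

Lemma is_inv_along_congr d e :
  right_ideal d = right_ideal e -> left_ideal d = left_ideal e ->
  is_inv_along d = is_inv_along e.
Proof. by move=> Er El; rewrite /is_inv_along Er El. Qed.

Lemma right_ideal_sub d e x : d = e * x ->
  right_ideal d `<=` right_ideal e.
Proof. by move=> -> _ [r _ <-]; exists (x * r) => //; rewrite mulrA. Qed.

Lemma left_ideal_sub d e x : d = x * e ->
  left_ideal d `<=` left_ideal e.
Proof. by move=> -> _ [r _ <-]; exists (r * x) => //; rewrite mulrA. Qed.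

Lemma is_group_inv_sym a b : is_group_inv a b -> is_group_inv b a.
Proof. by case=> aba bab ab. Qed.

Lemma is_group_invX a b n : is_group_inv a b ->
  is_group_inv (a ^+ n) (b ^+ n).
Proof.
case=> aba bab ab.
have abn : a ^+ n * b ^+ n = (a * b) ^+ n by rewrite exprMn_comm.
have ban : b ^+ n * a ^+ n = (a * b) ^+ n by rewrite ab exprMn_comm.
have cabn : GRing.comm (a * b) a by rewrite /GRing.comm aba ab mulrA aba.
have cbab : GRing.comm (a * b) b by rewrite /GRing.comm mulrA bab ab bab.
by split; rewrite ?abn ?ban // -exprMn_comm // ?aba // ab bab.
Qed.

(** [a * b] is idempotent, so its positive powers do not move. *)
Lemma group_inv_mulX a b n : is_group_inv a b -> (0 < n)%N ->
  a ^+ n * b ^+ n = a * b.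
Proof.
move=> [aba _ ab]; rewrite -exprMn_comm //.
case: n => // n _; elim: n => // n IH.
by rewrite exprS IH [LHS]mulrA aba.
Qed.

Lemma is_inv_along_group_inv a b : is_group_inv a b ->
  is_inv_along a = is_inv_along (a * b).
Proof.
case=> aba _ ab; apply: is_inv_along_congr; rewrite eqEsubset; split.
- by apply: (@right_ideal_sub _ _ a); rewrite aba.
- exact: (@right_ideal_sub _ _ b).
- by apply: (@left_ideal_sub _ _ a); rewrite ab mulrA aba.
- by apply: (@left_ideal_sub _ _ b); rewrite ab.
Qed.

Lemma is_inv_along_exp a b n : is_group_inv a b -> (0 < n)%N ->
  is_inv_along (a ^+ n) = is_inv_along (a * b) /\
  is_inv_along (b ^+ n) = is_inv_along (a * b).
Proof.
move=> gab n_gt0; have gba := is_group_inv_sym gab.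
split; first by rewrite (is_inv_along_group_inv (is_group_invX n gab))
  group_inv_mulX.
rewrite (is_inv_along_group_inv (is_group_invX n gba)) group_inv_mulX //.
by case: gba => _ _ ->.
Qed.

Lemma core_mulr a b : b * a * b = b -> a * b * a * b = a * b.
Proof. by move=> bab; rewrite -!mulrA (mulrA b) bab. Qed.

(** An outer inverse commuting with [a] forgets the part of [a] killed by the
    idempotent [a * b]; on what remains, the core [a * b * a], it is a genuine
    group inverse. *)
Lemma core_group_inv a b : b * a * b = b -> a * b = b * a ->
  is_group_inv (a * b * a) b.
Proof.
move=> bab ab; have coreb := core_mulr bab.
have bcore : b * (a * b * a) = a * b by rewrite !mulrA bab -ab.
split; last by rewrite coreb bcore.
- by rewrite coreb !mulrA coreb.
- by rewrite bcore ab bab.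
Qed.

Lemma core_exp a b n : b * a * b = b -> a * b = b * a -> (0 < n)%N ->
  (a * b * a) ^+ n = a ^+ n * b * a.
Proof.
move=> bab ab; case: n => // n _; elim: n => // n IH.
rewrite exprSr IH [in RHS]exprSr -!mulrA; congr (_ * _).
by rewrite !mulrA -ab core_mulr.
Qed.

(** Used with [b] the Drazin or the generalized Drazin inverse of [a]: both
    elements on the left are powers in the group-inverse pair formed by the
    core and [b], whose idempotent is again [a * b]. *)
Lemma is_inv_along_outer a b n : b * a * b = b -> a * b = b * a ->
  (0 < n)%N ->
  is_inv_along (b ^+ n) = is_inv_along (a * b) /\
  is_inv_along (a ^+ n * b * a) = is_inv_along (a * b).
Proof.
move=> bab ab n_gt0; have g := core_group_inv bab ab.
have [Ea Eb] := is_inv_along_exp g n_gt0.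
by rewrite -core_exp // Ea Eb core_mulr.
Qed.

(** Combined with [core_exp], this makes [a ^+ m] a power of the core: the part
    of [a] outside the core is nilpotent and has vanished at exponent [k]. *)
Lemma drazin_exp_core a b k m : is_drazin_inv_at k a b -> (k <= m)%N ->
  a ^+ m * b * a = a ^+ m.
Proof. by case=> akba _ _ /subnK <-; rewrite exprD -!mulrA (mulrA _ b) akba. Qed.

Lemma gdrazin_outer a b : is_gdrazin_inv a b ->
  b * a * b = b /\ a * b = b * a.
Proof.
case=> bicomm ab2 _.
have ba : b * a = a * b by exact: bicomm.
by split=> //; rewrite ba -mulrA -expr2.
Qed.

Lemma EP_group_inv (star : R -> R) a : is_EP star a ->
  is_group_inv a (mp_inv star a) /\
  star (a * mp_inv star a) = a * mp_inv star a.
Proof.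
by case=> /(xgetPex 0); rewrite -/(mp_inv star a) => -[? ? ? ?] ?.
Qed.

Lemma star_group_inv (star : R -> R) a b : is_ring_involution star ->
  is_group_inv a b -> star (a * b) = a * b ->
  is_group_inv (star a) (star b) /\ star a * star b = a * b.
Proof.
case=> _ starM _ [aba bab ab] sab; split; last by rewrite -starM -ab.
by split; rewrite -!starM ?mulrA ?aba ?bab ?ab.
Qed.

End CommonIdeals.

Theorem theorem5p4 (R : pzRingType) :
  (* (a) *)
  (forall a : R,
    (* (i) *)
    [/\ (group_invertible a -> forall n : nat, (0 < n)%N ->
          (invertible_along (a ^+ n) = invertible_along (group_inv a ^+ n) /\
           invertible_along (group_inv a ^+ n)
             = invertible_along (1 - group_idem a)) /\
          (forall x : R,
            [\/ invertible_along (a ^+ n) x,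
                invertible_along (group_inv a ^+ n) x
              | invertible_along (1 - group_idem a) x] ->
            inv_along x (a ^+ n) = inv_along x (group_inv a ^+ n) /\
            inv_along x (group_inv a ^+ n) = inv_along x (1 - group_idem a))),
    (* (ii): the elements not involving j, then those involving j *)
        (drazin_invertible a -> forall k : nat, is_drazin_index a k ->
          forall n m : nat, (0 < n)%N -> (k <= m)%N ->
          ((invertible_along (drazin_inv a ^+ n) = invertible_along (a ^+ m) /\
            invertible_along (a ^+ m) = invertible_along (1 - drazin_pi a)) /\
           (forall x : R,
             [\/ invertible_along (drazin_inv a ^+ n) x,
                 invertible_along (a ^+ m) x
               | invertible_along (1 - drazin_pi a) x] ->
             inv_along x (drazin_inv a ^+ n) = inv_along x (a ^+ m) /\
             inv_along x (a ^+ m) = inv_along x (1 - drazin_pi a))) /\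
          (forall j : nat, (1 <= j <= k - 1)%N ->
           [/\ invertible_along (drazin_inv a ^+ n) = invertible_along (a ^+ m),
               invertible_along (a ^+ m)
                 = invertible_along (a ^+ j * drazin_inv a * a)
             & invertible_along (a ^+ j * drazin_inv a * a)
                 = invertible_along (1 - drazin_pi a)] /\
           (forall x : R,
             [\/ invertible_along (drazin_inv a ^+ n) x,
                 invertible_along (a ^+ m) x,
                 invertible_along (a ^+ j * drazin_inv a * a) x
               | invertible_along (1 - drazin_pi a) x] ->
             [/\ inv_along x (drazin_inv a ^+ n) = inv_along x (a ^+ m),
                 inv_along x (a ^+ m)
                   = inv_along x (a ^+ j * drazin_inv a * a)
               & inv_along x (a ^+ j * drazin_inv a * a)
                   = inv_along x (1 - drazin_pi a)])))
    (* (iii) *)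
      & (gdrazin_invertible a -> forall n : nat, (0 < n)%N ->
          (invertible_along (gdrazin_inv a ^+ n)
             = invertible_along (a ^+ n * gdrazin_inv a * a) /\
           invertible_along (a ^+ n * gdrazin_inv a * a)
             = invertible_along (1 - gdrazin_pi a)) /\
          (forall x : R,
            [\/ invertible_along (gdrazin_inv a ^+ n) x,
                invertible_along (a ^+ n * gdrazin_inv a * a) x
              | invertible_along (1 - gdrazin_pi a) x] ->
            inv_along x (gdrazin_inv a ^+ n)
              = inv_along x (a ^+ n * gdrazin_inv a * a) /\
            inv_along x (a ^+ n * gdrazin_inv a * a)
              = inv_along x (1 - gdrazin_pi a)))]) /\
  (* (b), (iv) *)
  (forall star : R -> R, is_ring_involution star ->
    forall a : R, is_EP star a -> forall n : nat, (0 < n)%N ->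
    [/\ invertible_along (a ^+ n) = invertible_along (mp_inv star a ^+ n),
        invertible_along (mp_inv star a ^+ n)
          = invertible_along (star a ^+ n),
        invertible_along (star a ^+ n)
          = invertible_along (star (mp_inv star a) ^+ n)
      & invertible_along (star (mp_inv star a) ^+ n)
          = invertible_along (a * mp_inv star a)] /\
    (forall x : R,
      invertible_along (a ^+ n) x \/
      invertible_along (mp_inv star a ^+ n) x \/
      invertible_along (star a ^+ n) x \/
      invertible_along (star (mp_inv star a) ^+ n) x \/
      invertible_along (a * mp_inv star a) x ->
      [/\ inv_along x (a ^+ n) = inv_along x (mp_inv star a ^+ n),
          inv_along x (mp_inv star a ^+ n) = inv_along x (star a ^+ n),
          inv_along x (star a ^+ n) = inv_along x (star (mp_inv star a) ^+ n)
        & inv_along x (star (mp_inv star a) ^+ n)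
            = inv_along x (a * mp_inv star a)])).
Proof.
split=> [a|star star_inv a a_EP n n_gt0]; first split.
- move=> /(xgetPex 0); rewrite -/(group_inv a) => g n n_gt0.
  have [Ea Eb] := is_inv_along_exp g n_gt0.
  have {g} -> : 1 - group_idem a = a * group_inv a.
    by rewrite subKr; case: g => _ _ ->.
  by rewrite /invertible_along /inv_along Ea Eb.
- move=> _ k [k_gt0 dk _] n m n_gt0 le_km.
  have [_ bab ab] := dk.
  have [En _] := is_inv_along_outer bab ab n_gt0.
  have [_ Em] := is_inv_along_outer bab ab (leq_trans k_gt0 le_km).
  rewrite (drazin_exp_core dk le_km) in Em.
  have -> : 1 - drazin_pi a = a * drazin_inv a by rewrite subKr.
  split=> [|j /andP[j_gt0 _]].
    by rewrite /invertible_along /inv_along En Em.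
  have [_ Ej] := is_inv_along_outer bab ab j_gt0.
  by rewrite /invertible_along /inv_along En Em Ej.
- move=> /(xgetPex 0); rewrite -/(gdrazin_inv a) => /gdrazin_outer[bab ab].
  move=> n n_gt0.
  have [Eb Ea] := is_inv_along_outer bab ab n_gt0.
  have -> : 1 - gdrazin_pi a = a * gdrazin_inv a by rewrite subKr.
  by rewrite /invertible_along /inv_along Ea Eb.
have [g sab] := EP_group_inv a_EP.
have [gs Es] := star_group_inv star_inv g sab.
have [Ea Eb] := is_inv_along_exp g n_gt0.
have [Esa Esb] := is_inv_along_exp gs n_gt0.
rewrite Es in Esa Esb.
by rewrite /invertible_along /inv_along Ea Eb Esa Esb.
Qed.
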